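(* Let $m\ge 1$, $q=2^m$, $K=GF(q)$, let $i,t,s$ be positive integers, let $\delta\in K$ be nonzero, and let $d=\gcd(i,t)$. Define $$H(x,y)=\frac{x^{2^i-1}+y^{2^i-1}}{x^{2^d-1}+y^{2^d-1}}+\delta (xy)^{2^s-1}\,\frac{\left(x^{2^t-1}+y^{2^t-1}\right)^{2^s}}{x^{2^d-1}+y^{2^d-1}}\in K[x,y].$$ If $i$ does not divide $t$, then $H(x,y)$ is absolutely irreducible (i.e., irreducible over the algebraic closure of $K$).
   Context: Since $d$ divides $i$ and $t$, both quotients are polynomials. $H=F/U$ where $F(x,y)=x^{2^i-1}+y^{2^i-1}+\delta (xy)^{2^s-1}(x^{2^t-1}+y^{2^t-1})^{2^s}$ and $U=x^{2^d-1}+y^{2^d-1}$; $F(x,y)=\Delta_f(x,y)/(xy)$ for $f(x)=x^{2^i+1}+\delta x^{2^s(2^t+1)}$ and $\Delta_f(x,y)=f(x+y)+f(x)+f(y)$. *)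

(* Defs.v *)
From mathcomp Require Import all_boot all_order all_algebra all_field.
From mathcomp Require Import mpoly.

Set Implicit Arguments.
Unset Strict Implicit.
Unset Printing Implicit Defensive.

Import GRing.Theory.

Local Open Scope ring_scope.

Definition irreducible_elt (R : idomainType) (p : R) : Prop :=
  [/\ p != 0, p \isn't a GRing.unit
    & forall a b : R, p = a * b ->
        a \is a GRing.unit \/ b \is a GRing.unit].

(* L ranges over all algebraic closures of K: algebraically closed fields
   that are algebraic over the image of K (integralRange).  Such an L exists
   for finite K by countable_algebraic_closure. *)
Definition absolutely_irreducible (K : fieldType) (p : {mpoly K[2]}) : Prop :=
  forall (L : closedFieldType) (iota : {rmorphism K -> L}),
    integralRange iota -> irreducible_elt (map_mpoly iota p).

Definition polX (K : fieldType) : {mpoly K[2]} := 'X_ord0.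
Definition polY (K : fieldType) : {mpoly K[2]} := 'X_ord_max.

(* The formula for H, read in the fraction field K(x,y). *)
Definition H_frac (K : fieldType) (i t s : nat) (delta : K) :
    {fraction {mpoly K[2]}} :=
  let d := gcdn i t in
  let x := FracField.tofrac (polX K) in
  let y := FracField.tofrac (polY K) in
  let U := x ^+ (2 ^ d - 1)%N + y ^+ (2 ^ d - 1)%N in
  (x ^+ (2 ^ i - 1)%N + y ^+ (2 ^ i - 1)%N) / U
  + FracField.tofrac delta%:MP * (x * y) ^+ (2 ^ s - 1)%N
    * ((x ^+ (2 ^ t - 1)%N + y ^+ (2 ^ t - 1)%N) ^+ (2 ^ s)%N / U).

(* Main.v *)
From HB Require Import structures.
Require Import Defs.
From mathcomp Require Import all_boot all_order all_algebra all_field.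
From mathcomp Require Import mpoly.
From mathcomp Require Import zify.

Import GRing.Theory.
Local Open Scope ring_scope.

Set Implicit Arguments.
Unset Strict Implicit.
Unset Printing Implicit Defensive.

(** Put d = gcd(i, t) and M = 2^d - 1.  In characteristic 2, H = P + Q with P
    and Q forms in x, y of degrees a (even) and b (odd), where P is the quotient
    (x^(2^i-1) + y^(2^i-1)) / (x^M + y^M), and P and Q have no common zero other
    than the origin.  As d < i, P has a zero w, and it is a simple one.  The
    argument is then that of Eisenstein's criterion, for the grading by degree.
    Suppose F G = P + Q, and let F_n, G_n be the forms of degree n in F and G.
    Evaluating at w, where P vanishes and Q does not, shows that F_n(w) and
    G_n(w) are nonzero only for n = k resp. n = l, with k + l = b.  Since the
    derivative of P = sum_j F_j G_(a-j) does not vanish at w, one of the factors,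
    say F, also has a nonzero form of degree a - l, in addition to the one of
    degree k.  As F G has only two nonzero forms, comparing lowest and highest
    degrees gives G = G_l.  So G divides P and Q, hence has no zero other than
    the origin, and is constant. *)

(** * Univariate products with at most two nonzero terms *)

Lemma poly_low_coef (D : nzRingType) (f : {poly D}) j : f`_j != 0 ->
  exists l, [/\ f`_l != 0, (l <= j)%N & forall k, (k < l)%N -> f`_k = 0].
Proof.
move=> fj; have ex : exists l, f`_l != 0 by exists j.
exists (ex_minn ex); case: ex_minnP => l fl min; split=> //; first exact: min.
by move=> k; apply: contraTeq => /min; rewrite -leqNgt.
Qed.

Lemma coefM_low (D : nzRingType) (f g : {poly D}) l k :
  (forall j, (j < l)%N -> f`_j = 0) -> (forall j, (j < k)%N -> g`_j = 0) ->
  (f * g)`_(l + k) = f`_l * g`_k.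
Proof.
move=> f0 g0; have lt_l : (l < (l + k).+1)%N by rewrite ltnS leq_addr.
rewrite coefM (bigD1 (Ordinal lt_l)) //= addKn big1 ?addr0 // => j.
rewrite -val_eqE /= neq_ltn => /orP[lt_j|gt_j]; first by rewrite f0 ?mul0r.
by rewrite g0 ?mulr0 //; have := ltn_ord j; lia.
Qed.

(** Over a domain, lowest degrees add. Those of [f] and [g] are at most [j] and [l], and their sum
    is [j + l] or [k + l], so [g] starts exactly at [l]. Likewise the top degrees are at least [k]
    and [l] and must add up to [k + l], so [g] also ends at [l]. *)
Lemma monomial_of_binomial_mul (D : idomainType) (f g : {poly D}) j k l :
  f`_j != 0 -> f`_k != 0 -> (j < k)%N -> g`_l != 0 ->
  (forall n, n != (j + l)%N -> n != (k + l)%N -> (f * g)`_n = 0) ->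
  g = g`_l *: 'X^l.
Proof.
move=> fj fk ltjk gl fg0.
have fg n : (f * g)`_n != 0 -> n = (j + l)%N \/ n = (k + l)%N.
  move=> nz; case: (eqVneq n (j + l)%N) => [|n1]; first by left.
  case: (eqVneq n (k + l)%N) => [|n2]; first by right.
  by rewrite fg0 ?eqxx in nz.
have ltS (p : {poly D}) n : p`_n != 0 -> (n < size p)%N.
  by rewrite ltnNge; apply: contraNN => /(nth_default 0) ->.
have [lf [flf lelf f_lo]] := poly_low_coef fj.
have [lg [glg lelg g_lo]] := poly_low_coef gl.
have elg : lg = l.
  have /fg : (f * g)`_(lf + lg) != 0 by rewrite coefM_low // mulf_neq0.
  lia.
have f0 : f != 0 by apply: contraNneq fj => ->; rewrite coef0.
have g0 : g != 0 by apply: contraNneq gl => ->; rewrite coef0.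
have sg : size g = l.+1.
  have /fg : (f * g)`_(size (f * g)).-1 != 0.
    by rewrite -lead_coefE lead_coef_eq0 mulf_neq0.
  rewrite size_mul //; move: (ltS _ _ fk) (ltS _ _ gl); lia.
apply/polyP => n; rewrite coefZ coefXn; case: (ltngtP n l) => [lt|gt|->].
- by rewrite mulr0 g_lo // elg.
- by rewrite mulr0 nth_default // sg.
- by rewrite mulr1.
Qed.

(** Up to a nonzero scalar, the only divisors of ['X^n] are powers of ['X]. *)
Lemma monomial_of_mul (L : fieldType) (f g : {poly L}) c n :
  c != 0 -> f * g = c *: 'X^n ->
  exists k l, [/\ (k + l)%N = n, forall j, (f`_j != 0) = (j == k)
    & forall j, (g`_j != 0) = (j == l)].
Proof.
move=> c0 fgE.
have mono (p : {poly L}) : p %| 'X^n ->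
    exists2 u, u != 0 & exists k, p = u *: 'X^k.
  have -> : 'X^n = ('X - 0%:P) ^+ n :> {poly L} by rewrite subr0.
  move=> /dvdp_exp_XsubCP[k _]; rewrite subr0 => /eqpf_eq[u u0 ->].
  by exists u => //; exists k.
have [|u u0 [k fE]] := mono f.
  by rewrite -(dvdpZr _ _ c0) -fgE dvdp_mulr.
have [|v v0 [l gE]] := mono g.
  by rewrite -(dvdpZr _ _ c0) -fgE dvdp_mull.
have cE (w : L) m j : w != 0 -> ((w *: 'X^m)`_j != 0) = (j == m).
  by move=> w0; rewrite coefZ coefXn mulf_eq0 (negbTE w0);
    case: (j == m); rewrite ?eqxx ?oner_eq0.
exists k, l; split=> [|j|j]; rewrite ?fE ?gE ?cE //.
apply/eqP; rewrite eq_sym -(cE (u * v)) ?mulf_neq0 // exprD.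
have -> : (u * v) *: ('X^k * 'X^l) = c *: 'X^n.
  by rewrite -fgE fE gE -scalerAl -scalerAr scalerA.
by rewrite cE.
Qed.

(** * The grading of multivariate polynomials by degree *)

Lemma rmorph_mmap n (R : nzRingType) (S T : comNzRingType) (f : {rmorphism R -> S})
    (h : {rmorphism S -> T}) (v : 'I_n -> S) (p : {mpoly R[n]}) :
  h (mmap f v p) = mmap (h \o f) (h \o v) p.
Proof.
rewrite /mmap rmorph_sum; apply: eq_bigr => m _.
rewrite rmorphM; congr (_ * _); rewrite /mmap1 rmorph_prod.
by apply: eq_bigr => i _; rewrite rmorphXn.
Qed.

(* The coefficient of ['X^k] in [grade p] is the form of degree [k] in [p]. *)
Definition grade n (R : comNzRingType) : {mpoly R[n]} -> {poly {mpoly R[n]}} :=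
  mmap (polyC \o @mpolyC n R) (fun i => ('X_i)%:P * 'X).

HB.instance Definition _ n (R : comNzRingType) :=
  GRing.RMorphism.copy (@grade n R)
    (mmap (polyC \o @mpolyC n R) (fun i => ('X_i)%:P * 'X)).

(** Closure under products and powers is inherited from [grade] being a ring morphism. Zero is a
    form of every degree. *)
Definition is_form n (R : comNzRingType) k (p : {mpoly R[n]}) : Prop :=
  grade p = p *: 'X^k.

Section Grade.
Variables (n : nat) (R : comNzRingType).
Implicit Type p : {mpoly R[n]}.

Lemma gradeXU i : grade ('X_i : {mpoly R[n]}) = ('X_i)%:P * 'X.
Proof. by rewrite /grade mmapX mmap1U. Qed.

Lemma gradeC c : grade (c%:MP : {mpoly R[n]}) = (c%:MP)%:P.
Proof. by rewrite /grade mmapC. Qed.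

(** [grade p] is [p] with every variable multiplied by a new one, so giving that new variable the
    value [c] rescales the point. *)
Lemma horner_grade p w c :
  (map_poly (meval w) (grade p)).[c] = p.@[fun i => w i * c].
Proof.
rewrite -[LHS]/((horner_eval c \o map_poly (meval w)) (grade p)) /grade rmorph_mmap.
apply: eq_bigr => m _ /=; congr (_ * _).
  by rewrite map_polyC /= mevalC /horner_eval hornerC.
apply: eq_bigr => i _ /=; congr (_ ^+ _).
by rewrite rmorphM /= map_polyX map_polyC /= mevalXU /horner_eval !hornerE.
Qed.

Lemma horner_grade1 p : (grade p).[1] = p.
Proof.
rewrite -[LHS]/(horner_eval 1 (grade p)) /grade rmorph_mmap [RHS]mpolyE.
apply: eq_bigr => m _ /=; rewrite /horner_eval hornerC mul_mpolyC; congr (_ *: _).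
rewrite mpolyXE_id; apply: eq_bigr => i _ /=.
by rewrite !hornerE.
Qed.

Lemma horner_grade0 p : (grade p).[0] = (p.@[fun=> 0])%:MP.
Proof.
rewrite -[LHS]/(horner_eval 0 (grade p)) /grade /meval !rmorph_mmap.
apply: eq_bigr => m _ /=; rewrite /horner_eval hornerC; congr (_ * _).
by apply: eq_bigr => i _ /=; rewrite !hornerE ?mulr0 mpolyC0.
Qed.

Lemma is_form_eval k p w c : is_form k p -> p.@[fun i => w i * c] = p.@[w] * c ^+ k.
Proof.
move=> fp; rewrite -horner_grade fp -mul_polyC rmorphM /= map_polyC map_polyXn.
by rewrite /= hornerM hornerC hornerXn.
Qed.

Lemma is_form0 p : is_form 0 p -> p = (p.@[fun=> 0])%:MP.
Proof. by rewrite -horner_grade0 /is_form => ->; rewrite expr0 hornerZ hornerC mulr1. Qed.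

Lemma is_form_eval0 k p : (0 < k)%N -> is_form k p -> p.@[fun=> 0] = 0.
Proof.
move=> k0 /(is_form_eval (fun=> 0) 0).
by rewrite expr0n gtn_eqF //= !mulr0.
Qed.

Lemma is_formXU i : is_form 1 ('X_i : {mpoly R[n]}).
Proof. by rewrite /is_form gradeXU mul_polyC. Qed.

Lemma is_formC c : is_form 0 (c%:MP : {mpoly R[n]}).
Proof. by rewrite /is_form gradeC expr0 alg_polyC. Qed.

Lemma is_formM k l p q : is_form k p -> is_form l q -> is_form (k + l) (p * q).
Proof.
by rewrite /is_form rmorphM => /= -> ->; rewrite exprD -scalerAl -scalerAr scalerA.
Qed.

Lemma is_formD k p q : is_form k p -> is_form k q -> is_form k (p + q).
Proof. by rewrite /is_form rmorphD => /= -> ->; rewrite scalerDl. Qed.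

Lemma is_formX k l p : is_form k p -> is_form (k * l) (p ^+ l).
Proof. by rewrite /is_form rmorphXn => /= ->; rewrite exprZn exprM. Qed.

Lemma is_form_sum k (I : Type) (r : seq I) (P : pred I) (F : I -> {mpoly R[n]}) :
  (forall i, P i -> is_form k (F i)) -> is_form k (\sum_(i <- r | P i) F i).
Proof.
move=> fF; apply: big_ind => //; last exact: is_formD.
by rewrite /is_form rmorph0 scale0r.
Qed.

End Grade.

(** * Factorizations of a sum of two binary forms *)

Definition pt (R : Type) (u v : R) (i : 'I_2) : R := if i == ord0 then u else v.

(* Neither [p(X, 1)] nor [p(1, X)] has a root, so both are constant; if
   [k > 0], a root [v] of ['X^(k + 1) - 'X + 1] satisfies [v != 0]
   and [v ^ k != 1], against homogeneity. *)
Lemma form_nonvanishing_degree (L : closedFieldType) k (p : {mpoly L[2]}) :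
  is_form k p -> (forall w, p.@[w] = 0 -> forall i, w i = 0) -> k = 0%N.
Proof.
move=> fp nz; apply/eqP; rewrite -leqn0 leqNgt; apply/negP => k0.
have cst (g : 'I_2 -> {poly L}) i : g i = 1 ->
    forall x y, p.@[fun i => (g i).[x]] = p.@[fun i => (g i).[y]].
  move=> gi x y; pose r := mmap polyC g p.
  have rE z : r.[z] = p.@[fun i => (g i).[z]].
    rewrite -[LHS]/(horner_eval z r) /r rmorph_mmap /meval /mmap; apply: eq_bigr => m _.
    by rewrite /= /horner_eval hornerC.
  have /size_poly1P[c _ rc] : size r == 1%N.
    apply: contraT => /closed_rootP[z /rootP]; rewrite rE => /nz/(_ i)/eqP.
    by rewrite gi hornerC oner_eq0.
  by rewrite -!rE rc !hornerC.
have [v] : exists v : L, root ('X^(k.+1) - 'X + 1) v.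
  apply/closed_rootP; rewrite -addrA size_addl size_polyXn //.
  rewrite (leq_ltn_trans (size_add _ _)) // size_opp size_polyX size_poly1; lia.
rewrite /root !hornerE => /eqP vE.
have v0 : v != 0.
  by apply/eqP => v0; move/eqP: vE; rewrite v0 expr0n subrr add0r oner_eq0.
suff vk : v ^+ k = 1.
  by move/eqP: vE; rewrite exprS vk mulr1 subrr add0r oner_eq0.
(* Constancy gives p(1, v) = p(1, 1) = p(1/v, 1), while homogeneity gives p(1, v) = p(1/v, 1)
   v^k. *)
have e1 := cst (pt 1 'X) ord0 erefl 1 v.
have e2 := cst (pt 'X 1) ord_max erefl 1 v^-1.
have E (a b c d x : L) : a = c * x -> b = d * x ->
    p.@[pt a b] = p.@[pt c d] * x ^+ k.
  move=> -> ->; rewrite -(is_form_eval _ _ fp); apply: meval_eq => i.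
  by rewrite /pt; case: ifP.
have H u a b : p.@[fun i => (pt a b i).[u]] = p.@[pt a.[u] b.[u]].
  by apply: meval_eq => i; rewrite /pt; case: ifP.
rewrite !H !hornerE in e1 e2.
have p1 : p.@[pt 1 1] != 0.
  by apply/eqP => /nz/(_ ord0)/eqP; rewrite /pt eqxx oner_eq0.
apply: (mulfI p1); rewrite mulr1 [RHS]e1 {}e2; apply/esym.
by apply: E; rewrite ?mulVf ?mul1r.
Qed.

(** [monomial_of_binomial_mul], applied to [grade F] and [grade G] over the domain [{mpoly L[2]}],
    shows that [G] is a form of degree [l]. Comparing coefficients, [G] divides [P] and [Q], so each
    zero of [G] is a common zero of both. *)
Lemma factor_of_binary_forms_unit (L : closedFieldType) (P Q F G : {mpoly L[2]}) j k l :
  is_form (j + l) P -> is_form (k + l) Q -> P + Q = F * G -> j != k ->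
  (grade F)`_j != 0 -> (grade F)`_k != 0 -> (grade G)`_l != 0 ->
  (forall w, P.@[w] = 0 -> Q.@[w] = 0 -> forall i, w i = 0) ->
  G \is a GRing.unit.
Proof.
move=> fP fQ PQ neq_jk Fj Fk Gl nz.
have grE : grade F * grade G = P *: 'X^(j + l) + Q *: 'X^(k + l).
  by rewrite -fP -fQ -rmorphD -rmorphM -PQ.
have co n : n != (j + l)%N -> n != (k + l)%N -> (grade F * grade G)`_n = 0.
  by move=> /negbTE nj /negbTE nk; rewrite grE coefD !coefZ !coefXn nj nk !mulr0 addr0.
have mono : grade G = (grade G)`_l *: 'X^l.
  move: neq_jk; rewrite neq_ltn => /orP[lt_jk|lt_kj].
    exact: (monomial_of_binomial_mul Fj Fk).
  by apply: (monomial_of_binomial_mul Fk Fj) => // n nk nj; apply: co.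
have GE : G = (grade G)`_l.
  rewrite -[LHS]horner_grade1 mono hornerZ hornerXn expr1n mulr1.
  by rewrite coefZ coefXn eqxx mulr1.
have fG : is_form l G by rewrite /is_form [LHS]mono -GE.
have coE n : (grade F)`_n * G = (grade F * grade G)`_(n + l).
  by rewrite fG -scalerAr coefZ coefMXn ltnNge leq_addl /= addnK mulrC.
have PE : P = (grade F)`_j * G.
  rewrite coE grE coefD !coefZ !coefXn eqxx eqn_add2r (negbTE neq_jk).
  by rewrite mulr1 mulr0 addr0.
have QE : Q = (grade F)`_k * G.
  rewrite coE grE coefD !coefZ !coefXn eqxx eqn_add2r eq_sym (negbTE neq_jk).
  by rewrite mulr1 mulr0 add0r.
have l0 : l = 0%N.
  apply: form_nonvanishing_degree fG _ => w Gw.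
  by apply: nz; rewrite (PE, QE) mevalM Gw mulr0.
move: fG; rewrite l0 => /is_form0 Gc; rewrite Gc; apply: rmorph_unit.
by rewrite unitfE; apply: contraNneq Gl => c0; rewrite -GE Gc c0 mpolyC0.
Qed.

(** The point [w] plays the part of the prime in Eisenstein's criterion: [P] vanishes there to order
    exactly one, and [Q] does not vanish. *)
Lemma irreducible_add_forms (L : closedFieldType) (P Q : {mpoly L[2]}) a b w i :
  is_form a P -> is_form b Q -> (0 < a)%N -> (0 < b)%N -> a != b ->
  P.@[w] = 0 -> P^`M(i).@[w] != 0 -> Q.@[w] != 0 ->
  (forall v, P.@[v] = 0 -> Q.@[v] = 0 -> forall j, v j = 0) ->
  irreducible_elt (P + Q).
Proof.
move=> fP fQ a0 b0 neq_ab Pw dPw Qw nz.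
have PQw : (P + Q).@[w] != 0 by rewrite mevalD Pw add0r.
have PQ0 : (P + Q).@[fun=> 0] = 0.
  by rewrite mevalD (is_form_eval0 a0 fP) (is_form_eval0 b0 fQ) addr0.
split=> [||F G PQ].
- by apply: contraNneq PQw => ->; rewrite meval0.
- apply: contraTN isT => /(rmorph_unit (meval (fun=> 0))).
  by rewrite /= PQ0 unitr0.
have grE : grade F * grade G = P *: 'X^a + Q *: 'X^b.
  by rewrite -fP -fQ -rmorphD -rmorphM -PQ.
have [k [l [kl Fk Gl]]] : exists k l, [/\ (k + l)%N = b,
    forall j, (((grade F)`_j).@[w] != 0) = (j == k)
  & forall j, (((grade G)`_j).@[w] != 0) = (j == l)].
  have : map_poly (meval w) (grade F) * map_poly (meval w) (grade G) = Q.@[w] *: 'X^b.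
    by rewrite -rmorphM grE rmorphD /= !linearZ_LR /= !map_polyXn Pw scale0r add0r.
  move=> /(monomial_of_mul Qw)[k [l [kl Fk Gl]]]; exists k, l.
  by split=> // j; rewrite -(Fk, Gl) coef_map.
have PE : P = \sum_(j < a.+1) (grade F)`_j * (grade G)`_(a - j).
  by rewrite -coefM grE coefD !coefZ !coefXn eqxx (negbTE neq_ab) mulr1 mulr0 addr0.
have unitF := @factor_of_binary_forms_unit L P Q G F.
have unitG := @factor_of_binary_forms_unit L P Q F G.
move: (grade F) (grade G) Fk Gl PE unitF unitG {grE} => f g Fk Gl PE unitF unitG.
have meval_neq0 (p : {mpoly L[2]}) : p.@[w] != 0 -> p != 0.
  by apply: contraNneq => ->; rewrite meval0.
have fk : f`_k != 0 by apply: meval_neq0; rewrite Fk.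
have gl : g`_l != 0 by apply: meval_neq0; rewrite Gl.
(* The derivative of [P] at [w] is the sum of those of the products [f_j g_(a-j)], so one of these
   is nonzero. *)
have [j dj] : exists j : 'I_a.+1, ((f`_j * g`_(a - j))^`M(i)).@[w] != 0.
  apply/existsP; apply: contraNT dPw => /existsPn d0.
  rewrite PE (big_morph _ (@mderivD _ _ i) (@mderiv0 _ _ i)).
  rewrite (big_morph _ (mevalD w) (meval0 w)) big1 // => j _.
  by apply/eqP; have := d0 j; rewrite negbK.
have ja : (j + (a - j))%N = a by rewrite subnKC // -ltnS.
have fj : f`_j != 0.
  by apply: contraNneq dj => ->; rewrite mul0r mderiv0 meval0.
have gaj : g`_(a - j) != 0.
  by apply: contraNneq dj => ->; rewrite mulr0 mderiv0 meval0.
(* If [j = k], then [a - j] differs from [l] because [a] differs from [b = k + l]: now [g] has forms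
   of two degrees, and [F] is the unit. If [a - j = l], the roles are exchanged. *)
have [jk|jk] := eqVneq (nat_of_ord j) k.
  left; apply: (unitF (a - j)%N l k) => //.
  - by rewrite addnC -jk ja.
  - by rewrite addnC kl.
  - by rewrite mulrC.
  - by apply: contraNneq neq_ab => e; rewrite -kl -e -jk ja.
have [ajl|ajl] := eqVneq (a - j)%N l.
  right; apply: (unitG j k l) => //; rewrite ?kl -?ajl ?ja //.
(* Otherwise both factors vanish at [w], and by Leibniz so does the derivative of their product. *)
case/eqP: dj; rewrite mderivM mevalD !mevalM.
have -> : (g`_(a - j)).@[w] = 0 by apply/eqP; rewrite -[_ == _]negbK Gl.
have -> : (f`_j).@[w] = 0 by apply/eqP; rewrite -[_ == _]negbK Fk.
by rewrite mulr0 mul0r addr0.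
Qed.

(** * Geometric sums, characteristic 2, and exponents 2^e - 1 *)

Section Geometric.
Variable R : comNzRingType.
Implicit Types x y : R.

(** A division-free quotient of x^n - y^n by x - y: it commutes with ring morphisms and keeps a
    meaning at x = y. *)
Definition geom n x y : R := \sum_(i < n) x ^+ (n.-1 - i) * y ^+ i.

Lemma geomE n x y : (x - y) * geom n x y = x ^+ n - y ^+ n.
Proof. by rewrite subrXX. Qed.

Lemma geomxx n x : geom n x x = x ^+ n.-1 *+ n.
Proof.
rewrite /geom (eq_bigr (fun=> x ^+ n.-1)) => [|[j /= lt_jn] _].
  by rewrite sumr_const card_ord.
by rewrite -exprD subnK //; lia.
Qed.

Hypothesis R2 : 2 \in [pchar R].

Lemma geomE_pchar2 n x y : (x + y) * geom n x y = x ^+ n + y ^+ n.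
Proof. by rewrite -{1}(oppr_pchar2 R2 y) geomE (oppr_pchar2 R2). Qed.

Lemma natr_odd_pchar2 n : odd n -> n%:R = 1 :> R.
Proof.
move=> odd_n; rewrite -[n]odd_double_half odd_n -muln2.
by rewrite natrD natrM (pcharf0 R2) mulr0 addr0.
Qed.

End Geometric.

Lemma rmorph_geom (R S : comNzRingType) (h : {rmorphism R -> S}) n x y :
  h (geom n x y) = geom n (h x) (h y).
Proof.
by rewrite rmorph_sum; apply: eq_bigr => j _; rewrite rmorphM !rmorphXn.
Qed.

Lemma pchar_mpoly n (R : comNzRingType) p : p \in [pchar R] -> p \in [pchar {mpoly R[n]}].
Proof. exact: (rmorph_pchar (@mpolyC n R)). Qed.

Lemma mderivXn n (R : comNzRingType) (i : 'I_n) k :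
  ('X_i ^+ k.+1 : {mpoly R[n]})^`M(i) = 'X_i ^+ k *+ k.+1.
Proof.
have X1 : ('X_i : {mpoly R[n]})^`M(i) = 1.
  rewrite mderivX mnm1E eqxx scale1r.
  by have := addmK U_(i) 0%MM; rewrite add0m => ->; rewrite mpolyX0.
elim: k => [|k IHk]; first by rewrite expr1 expr0 X1.
by rewrite exprS mderivM IHk X1 mul1r mulrnAr -exprS -mulrS.
Qed.

(** Such an [x] is fixed by raising to the powers 2^i and 2^t, hence by all their iterates. The
    Bezout relation a i = b t + gcd(i, t) then makes it fixed by the power 2^gcd(i, t). *)
Lemma expr_pow2_gcd (L : fieldType) (x : L) i t : (0 < i)%N ->
  x ^+ (2 ^ i - 1)%N = 1 -> x ^+ (2 ^ t - 1)%N = 1 -> x ^+ (2 ^ gcdn i t - 1)%N = 1.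
Proof.
move=> i0 xi xt.
have fix_iter j : x ^+ (2 ^ j - 1)%N = 1 -> forall c, x ^+ (2 ^ (j * c)) = x.
  move=> xj; elim=> [|c IHc]; first by rewrite muln0 expr1.
  have ej : (2 ^ j = (2 ^ j - 1).+1)%N by have := expn_gt0 2 j; lia.
  by rewrite mulnS addnC expnD exprM IHc ej exprS xj mulr1.
have x0 : x != 0.
  apply: contra_eq_neq xi => ->; rewrite expr0n eqn0Ngt subn_gt0.
  by rewrite -{1}(expn0 2) ltn_exp2l // i0 eq_sym oner_eq0.
case: (egcdnP t i0) => a b eab _.
apply: (mulfI x0); rewrite mulr1 -exprS.
have -> : (2 ^ gcdn i t - 1).+1 = (2 ^ gcdn i t)%N by have := expn_gt0 2 (gcdn i t); lia.
by rewrite -{1}(fix_iter t xt b) -exprM -expnD mulnC -eab mulnC fix_iter.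
Qed.

Lemma dvdn_pow2_pred d i : (d %| i)%N -> (2 ^ d - 1 %| 2 ^ i - 1)%N.
Proof.
by case/dvdnP=> c ->; rewrite mulnC expnM !subn1 (predn_exp (2 ^ d)) dvdn_mulr.
Qed.

(** * The two forms that make up H *)

(** In characteristic 2 with [d] dividing [i], this is the quotient of x^(2^i-1) + y^(2^i-1) by U =
    x^(2^d-1) + y^(2^d-1). It serves for [t] in place of [i] as well. *)
Definition low_form (R : comNzRingType) d i : {mpoly R[2]} :=
  geom ((2 ^ i - 1) %/ (2 ^ d - 1))%N ('X_ord0 ^+ (2 ^ d - 1)%N)
    ('X_ord_max ^+ (2 ^ d - 1)%N).

(** The 2^s-th power of U * [low_form R d t], divided by U, keeps U to the power 2^s - 1. *)
Definition high_form (R : comNzRingType) d t s (delta : R) : {mpoly R[2]} :=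
  delta%:MP * ('X_ord0 * 'X_ord_max) ^+ (2 ^ s - 1)%N
  * (low_form R d t ^+ (2 ^ s)%N
     * ('X_ord0 ^+ (2 ^ d - 1)%N + 'X_ord_max ^+ (2 ^ d - 1)%N) ^+ (2 ^ s - 1)%N).

Lemma form_low_form (R : comNzRingType) d i :
  is_form ((2 ^ d - 1) * ((2 ^ i - 1) %/ (2 ^ d - 1)).-1)%N (low_form R d i).
Proof.
set M := (2 ^ d - 1)%N; apply: is_form_sum => -[j /= lt_j] _.
set k := (_ %/ M)%N in lt_j *.
have -> : (M * k.-1 = M * (k.-1 - j) + M * j)%N by rewrite -mulnDr subnK //; lia.
apply: is_formM; apply: is_formX; rewrite -[M in is_form M _]mul1n;
  by apply: is_formX; apply: is_formXU.
Qed.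

(** The degree stays a sum over the factors, from which positivity and parity are read off. *)
Lemma form_high_form (R : comNzRingType) d t s (delta : R) :
  is_form (0 + 2 * (2 ^ s - 1)
        + ((2 ^ d - 1) * ((2 ^ t - 1) %/ (2 ^ d - 1)).-1 * 2 ^ s
           + (2 ^ d - 1) * (2 ^ s - 1)))%N (high_form d t s delta).
Proof.
have fX i : is_form (2 ^ d - 1)%N ('X_i ^+ (2 ^ d - 1)%N : {mpoly R[2]}).
  by rewrite -[X in is_form X _]mul1n; apply: is_formX; apply: is_formXU.
apply: is_formM; first apply: is_formM.
- exact: is_formC.
- by apply: is_formX; apply: (@is_formM _ _ 1 1); apply: is_formXU.
- by apply: is_formM; apply: is_formX; [apply: form_low_form | apply: is_formD].
Qed.

Lemma map_low_form (R S : comNzRingType) (h : {rmorphism R -> S}) d i :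
  map_mpoly h (low_form R d i) = low_form S d i.
Proof. by rewrite rmorph_geom !rmorphXn /= !map_mpolyX. Qed.

Lemma map_high_form (R S : comNzRingType) (h : {rmorphism R -> S}) d t s delta :
  map_mpoly h (high_form d t s delta) = high_form d t s (h delta).
Proof.
rewrite !rmorphM !rmorphXn rmorphM rmorphD !rmorphXn /= map_low_form.
by rewrite map_mpolyC !map_mpolyX.
Qed.

Lemma meval_low_form (R : comNzRingType) d i (w : 'I_2 -> R) :
  (low_form R d i).@[w]
  = geom ((2 ^ i - 1) %/ (2 ^ d - 1))%N (w ord0 ^+ (2 ^ d - 1)%N)
      (w ord_max ^+ (2 ^ d - 1)%N).
Proof. by rewrite rmorph_geom !rmorphXn /= !mevalXU. Qed.

Lemma low_formE (R : comNzRingType) d i : 2 \in [pchar R] -> (d %| i)%N ->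
  ('X_ord0 ^+ (2 ^ d - 1)%N + 'X_ord_max ^+ (2 ^ d - 1)%N) * low_form R d i
  = 'X_ord0 ^+ (2 ^ i - 1)%N + 'X_ord_max ^+ (2 ^ i - 1)%N.
Proof.
move=> R2 /dvdn_pow2_pred di.
by rewrite geomE_pchar2 ?pchar_mpoly // -!exprM [(_ * (_ %/ _))%N]mulnC divnK.
Qed.

Lemma low_form_eval (R : comNzRingType) d i (w : 'I_2 -> R) :
  2 \in [pchar R] -> (d %| i)%N ->
  (w ord0 ^+ (2 ^ d - 1)%N + w ord_max ^+ (2 ^ d - 1)%N) * (low_form R d i).@[w]
  = w ord0 ^+ (2 ^ i - 1)%N + w ord_max ^+ (2 ^ i - 1)%N.
Proof.
move=> R2 di; have := congr1 (meval w) (low_formE R2 di).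
by rewrite mevalM !mevalD !rmorphXn /= !mevalXU.
Qed.

(** At a common zero other than the origin both coordinates and U are nonzero, so [low_form]
    vanishes for [t] as well as for [i]. The ratio of the coordinates is then a root of unity of
    orders dividing 2^i - 1 and 2^t - 1, hence 2^d - 1, which forces U = 0. *)
Lemma low_high_no_common_zero (L : fieldType) i t s (delta : L) (w : 'I_2 -> L) :
  2 \in [pchar L] -> (0 < i)%N -> delta != 0 ->
  (low_form L (gcdn i t) i).@[w] = 0 -> (high_form (gcdn i t) t s delta).@[w] = 0 ->
  forall j, w j = 0.
Proof.
set d := gcdn i t => L2 i0 delta0 lo0 hi0.
have addeq0 (x y : L) : x + y = 0 -> x = y.
  by move/eqP; rewrite addr_eq0 (oppr_pchar2 L2) => /eqP.
have N0 : (0 < 2 ^ i - 1)%N by rewrite subn_gt0 -{1}(expn0 2) ltn_exp2l.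
have wi : w ord0 ^+ (2 ^ i - 1)%N = w ord_max ^+ (2 ^ i - 1)%N.
  by apply: addeq0; rewrite -(low_form_eval w L2 (dvdn_gcdl i t)) lo0 mulr0.
have [w1|w1] := eqVneq (w ord_max) 0.
  have w0 : w ord0 = 0.
    by apply/eqP; move/eqP: wi; rewrite w1 expr0n gtn_eqF //= expf_eq0 N0.
  move=> j; case: (unliftP ord0 j) => [j' ->|-> //].
  by rewrite -w1; congr w; apply: val_inj; rewrite /= ord1.
exfalso.
have odd_k : odd ((2 ^ i - 1) %/ (2 ^ d - 1)).
  have : odd (2 ^ i - 1) by rewrite oddB ?expn_gt0 // oddX gtn_eqF.
  by rewrite -{1}(divnK (dvdn_pow2_pred (dvdn_gcdl i t))) oddM => /andP[].
(* If U vanished, the geometric sum would have equal arguments and be an odd multiple of a power of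
   the nonzero second coordinate. *)
have U0 : w ord0 ^+ (2 ^ d - 1)%N + w ord_max ^+ (2 ^ d - 1)%N != 0.
  apply/eqP => /addeq0 eqU; move/eqP: lo0.
  rewrite meval_low_form eqU geomxx -mulr_natl natr_odd_pchar2 // mul1r.
  by rewrite !expf_eq0 (negbTE w1) !andbF.
have w0 : w ord0 != 0.
  apply: contra_neqN w1 => /eqP w0; move: wi; rewrite w0 expr0n gtn_eqF //= => /esym/eqP.
  by rewrite expf_eq0 N0 => /eqP.
move/eqP: hi0; rewrite !mevalM !rmorphXn /= mevalM mevalD !rmorphXn /= mevalC !mevalXU.
rewrite !mulf_eq0 !expf_eq0 !mulf_eq0 (negbTE w0) (negbTE w1) (negbTE U0) (negbTE delta0).
rewrite !andbF /= orbF => /andP[_ /eqP t0].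
have wt : w ord0 ^+ (2 ^ t - 1)%N = w ord_max ^+ (2 ^ t - 1)%N.
  by apply: addeq0; rewrite -(low_form_eval w L2 (dvdn_gcdr i t)) t0 mulr0.
have ratio n : w ord0 ^+ n = w ord_max ^+ n <-> (w ord0 / w ord_max) ^+ n = 1.
  rewrite expr_div_n; split=> [->|/divr1_eq //]; by rewrite divff ?expf_neq0.
case/eqP: U0; rewrite (ratio _).2 ?(addrr_pchar2 L2) //.
by apply: expr_pow2_gcd => //; apply/ratio.
Qed.

(** Setting y = 1 gives (X^(2^i-1) - 1) / (X^(2^d-1) - 1), of positive degree as d < i. Its roots
    are simple because 2^i - 1 is odd. *)
Lemma low_form_simple_zero (L : closedFieldType) d i :
  2 \in [pchar L] -> (0 < d)%N -> (d < i)%N -> (d %| i)%N ->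
  exists a : L, (low_form L d i).@[pt a 1] = 0
    /\ (low_form L d i)^`M(ord0).@[pt a 1] != 0.
Proof.
move=> L2 d0 lt_di di.
have lt_M : (0 < 2 ^ d - 1 < 2 ^ i - 1)%N.
  have : (2 ^ 0 < 2 ^ d < 2 ^ i)%N by rewrite !ltn_exp2l // d0.
  lia.
have [M0 N0] : (0 < 2 ^ d - 1 /\ 0 < 2 ^ i - 1)%N by lia.
pose g := geom ((2 ^ i - 1) %/ (2 ^ d - 1)) ('X^(2 ^ d - 1)%N) 1 : {poly L}.
have gE : ('X^(2 ^ d - 1)%N - 1) * g = 'X^(2 ^ i - 1)%N - 1.
  by rewrite geomE -exprM expr1n mulnC divnK ?dvdn_pow2_pred.
have [a /rootP ga] : exists a, root g a.
  apply/closed_rootP.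
  have g0 : g != 0.
    apply: contra_eq_neq gE => ->.
    by rewrite mulr0 eq_sym -size_poly_eq0 -polyC1 size_XnsubC.
  have := congr1 (fun p : {poly L} => size p) gE.
  rewrite size_mul //; last by rewrite -size_poly_eq0 -polyC1 size_XnsubC.
  rewrite -polyC1 !size_XnsubC //= => eS; apply/eqP => g1; rewrite g1 in eS; lia.
have Pa : (low_form L d i).@[pt a 1] = 0.
  rewrite meval_low_form /pt /= expr1n -ga -[RHS]/(horner_eval a g) rmorph_geom.
  by rewrite rmorphXn rmorph1 /= /horner_eval hornerX.
exists a; split=> //.
have a0 : a != 0.
  have := low_form_eval (pt a 1) L2 di; rewrite Pa mulr0 /pt /= expr1n => /esym/eqP.
  by apply: contraTneq => ->; rewrite expr0n gtn_eqF //= add0r oner_eq0.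
(* Differentiating U P = x^N + y^N in x at the zero of P leaves U P' = N a^(N-1), where N = 2^i - 1
   is odd and [a] is nonzero. *)
have := congr1 (fun p => (p^`M(ord0)).@[pt a 1]) (low_formE L2 di).
rewrite mderivM !mderivD !mevalD !mevalM Pa mulr0 add0r.
have dY n : (('X_ord_max ^+ n : {mpoly L[2]})^`M(ord0)).@[pt a 1] = 0.
  elim: n => [|n IHn]; first by rewrite expr0 -mpolyC1 mderivC meval0.
  by rewrite exprS mderivM mderivX mnm1E /= scale0r mul0r add0r mevalM IHn mulr0.
rewrite dY addr0 => dE.
have : (('X_ord0 ^+ (2 ^ i - 1)%N : {mpoly L[2]})^`M(ord0)).@[pt a 1] != 0.
  rewrite -(prednK N0) mderivXn -mulr_natl rmorphM rmorph_nat /= natr_odd_pchar2 //.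
    by rewrite mul1r rmorphXn /= mevalXU expf_neq0.
  by rewrite prednK // oddB ?expn_gt0 // oddX gtn_eqF //; lia.
by rewrite -dE mulf_eq0 negb_or => /andP[].
Qed.

(** * Irreducibility of H *)

Lemma irreducible_low_high (L : closedFieldType) i t s (delta : L) :
  2 \in [pchar L] -> (0 < i)%N -> (0 < t)%N -> (0 < s)%N -> delta != 0 -> ~~ (i %| t)%N ->
  irreducible_elt (low_form L (gcdn i t) i + high_form (gcdn i t) t s delta).
Proof.
move=> L2 i0 t0 s0 delta0 nit; set d := gcdn i t.
have d0 : (0 < d)%N by rewrite gcdn_gt0 i0.
have lt_di : (d < i)%N.
  rewrite ltn_neqAle dvdn_leq ?dvdn_gcdl // andbT.
  by apply: contraNneq nit => <-; apply: dvdn_gcdr.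
have [a [Pa dPa]] := low_form_simple_zero L2 d0 lt_di (dvdn_gcdl i t).
have nz w := @low_high_no_common_zero _ i t s delta w L2 i0 delta0.
have odd_pred e : (0 < e)%N -> odd (2 ^ e - 1).
  by move=> e0; rewrite oddB ?expn_gt0 // oddX gtn_eqF.
have lt_M : (0 < 2 ^ d - 1 < 2 ^ i - 1)%N.
  have : (2 ^ 0 < 2 ^ d < 2 ^ i)%N by rewrite !ltn_exp2l // d0.
  lia.
have [M0 N0] : (0 < 2 ^ d - 1 /\ 0 < 2 ^ i - 1)%N by lia.
have s1 : (0 < 2 ^ s - 1)%N by rewrite odd_gt0 ?odd_pred.
have kE := divnK (dvdn_pow2_pred (dvdn_gcdl i t)).
have odd_k : odd ((2 ^ i - 1) %/ (2 ^ d - 1)).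
  by have := odd_pred i i0; rewrite -{1}kE oddM => /andP[].
have k1 : (1 < (2 ^ i - 1) %/ (2 ^ d - 1))%N.
  case: (_ %/ _)%N odd_k kE => [|[|k]] //= _; rewrite mul1n -/d => e.
  by move: lt_M; rewrite e ltnn andbF.
apply: (irreducible_add_forms (@form_low_form _ _ _)
  (@form_high_form _ _ _ _ _) _ _ _ Pa dPa).
- by rewrite muln_gt0 M0; lia.
- by rewrite add0n addn_gt0 muln_gt0 s1.
(* The low degree is even since the number of terms of the geometric sum is odd. In the high degree
   only the summand (2^d - 1)(2^s - 1) is odd. *)
- apply/eqP => /(congr1 odd).
  rewrite !(oddD, oddM) /= !oddX !odd_pred // gtn_eqF //= andbF /=.
  by rewrite -subn1 oddB ?(ltnW k1) // odd_k.
- by apply/eqP => /(nz _ Pa)/(_ ord_max)/eqP; rewrite /pt /= oner_eq0.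
- by move=> v; apply: nz.
Qed.

Theorem theorem3 (m : nat) (K : finFieldType) (i t s : nat) (delta : K)
  (hm : (1 <= m)%N) (hK : #|K| = (2 ^ m)%N)
  (hi : (0 < i)%N) (ht : (0 < t)%N) (hs : (0 < s)%N) (hdelta : delta != 0)
  (hit : ~~ (i %| t)%N) :
  exists H : {mpoly K[2]},
    FracField.tofrac H = H_frac i t s delta /\ absolutely_irreducible H.
Proof.
have K2 : 2 \in [pchar K] by apply: card_finPcharP hK _.
pose d := gcdn i t.
exists (low_form K d i + high_form d t s delta); split; last first.
  (* Both forms commute with extension of scalars, which only replaces [delta] by its image. *)
  move=> L iota _; rewrite rmorphD /= map_low_form map_high_form.
  by apply: irreducible_low_high; rewrite ?fmorph_eq0 // (fmorph_pchar iota).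
pose U : {mpoly K[2]} := 'X_ord0 ^+ (2 ^ d - 1)%N + 'X_ord_max ^+ (2 ^ d - 1)%N.
have U0 : U != 0.
  apply/eqP => /(congr1 (meval (pt 1 0)))/eqP.
  rewrite mevalD !rmorphXn /= !mevalXU meval0 /pt /= expr1n expr0n gtn_eqF.
    by rewrite addr0 oner_eq0.
  by rewrite subn_gt0 -{1}(expn0 2) ltn_exp2l // gcdn_gt0 hi.
have F0 : FracField.tofrac U != 0 by rewrite tofrac_eq0.
rewrite /H_frac -/d /polX /polY.
have pow e :
    FracField.tofrac ('X_ord0 : {mpoly K[2]}) ^+ e + FracField.tofrac 'X_ord_max ^+ e
  = FracField.tofrac ('X_ord0 ^+ e + 'X_ord_max ^+ e).
  by rewrite tofracD !tofracXn.
(* Each numerator becomes U times a [low_form]; cancelling one U from each quotient leaves the power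
   2^s - 1 of U in the second. *)
rewrite !pow -(low_formE K2 (dvdn_gcdl i t)) -(low_formE K2 (dvdn_gcdr i t)) -/d -/U.
rewrite tofracD /high_form -/U !tofracM !tofracXn !tofracM.
rewrite [in RHS]mulrC mulKf //; congr (_ + _ * _).
rewrite exprMn [RHS]mulrAC [LHS]mulrC; congr (_ * _).
have -> : (2 ^ s)%N = (2 ^ s - 1).+1 by rewrite subn1 prednK ?expn_gt0.
by rewrite exprSr mulfK // subn1.
Qed.
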